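(* Let $(\mathfrak{g},[-,-]_{\mathfrak{g}},P)$ be a Rota-Baxter Lie algebra of weight zero. Suppose that $Q:\mathfrak{g}\rightarrow \mathfrak{g}$ is a linear map that is admissible to $(\mathfrak{g},[-,-]_{\mathfrak{g}},P)$ and commutes with $P$. Let $[-,-]$ be the bracket on the Lie algebra $\mathfrak{g}\ltimes_{\mathrm{ad}^{*}}\mathfrak g^{*}$, and let $\delta=\delta_{r}$ be the linear map defined by $\delta_r(a)=(\mathrm{ad}(a)\otimes\mathrm{id}+\mathrm{id}\otimes\mathrm{ad}(a))r$ for $a\in\mathfrak{g}\ltimes_{\mathrm{ad}^{*}}\mathfrak g^{*}$, with $r=P-\tau(P)$. Then there is a special L-dendriform bialgebra $(\mathfrak{g}\ltimes_{\mathrm{ad}^{*}}\mathfrak g^{*},\triangleright,\triangleleft,\Delta,\nabla)$, where for all $a,b\in \mathfrak{g}\ltimes_{\mathrm{ad}^{*}}\mathfrak g^{*}$, $$a\triangleleft b=-(Q+P^{*})([a,b]),\quad a\triangleright b=[(P+Q^{*})a,b]+(Q+P^{*})[a,b],$$ $$\nabla(a)=-\delta((P+Q^{*})a),\quad \Delta(a)=((Q+P^{*})\otimes\mathrm{id})\delta(a)+\delta((P+Q^{*})a).$$ In particular, there are two special L-dendriform bialgebras $(\mathfrak{g}\ltimes_{\mathrm{ad}^{*}}\mathfrak g^{*},\triangleright_1,\triangleleft_1,\Delta_1,\nabla_1)$ and $(\mathfrak{g}\ltimes_{\mathrm{ad}^{*}}\mathfrak g^{*},\triangleright_2,\triangleleft_2,\Delta_2,\nabla_2)$,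 where $$a\triangleleft_1 b=-(-P+P^{*})([a,b]),\quad a\triangleright_1 b=[(P-P^{*})a,b]+(-P+P^{*})[a,b],$$ $$\nabla_1(a)=-\delta((P-P^{*})a),\quad \Delta_1(a)=((-P+P^{*})\otimes\mathrm{id})\delta(a)+\delta((P-P^{*})a),$$ $$a\triangleleft_{2} b=-P^{*}([a,b]),\quad a\triangleright_{2} b=[P(a),b]+P^{*}([a,b]),$$ $$\nabla_2(a)=-\delta(P(a)),\quad \Delta_2(a)=(P^{*}\otimes\mathrm{id})\delta(a)+\delta(P(a)).$$
   Context: All vector spaces and algebras are finite-dimensional over a field of characteristic zero; $\tau$ is the flip. A Rota-Baxter Lie algebra of weight zero is $(\mathfrak{g},[-,-]_{\mathfrak g},P)$ with $[P(x),P(y)]_{\mathfrak g}=P([x,P(y)]_{\mathfrak g})+P([P(x),y]_{\mathfrak g})$. $Q$ is admissible to it if $Q([P(x),y]_{\mathfrak g})-[P(x),Q(y)]_{\mathfrak g}-Q([x,Q(y)]_{\mathfrak g})=0$ for all $x,y$. $\mathrm{ad}^*$ is given by $\langle\mathrm{ad}^*(x)a^*,y\rangle=-\langle a^*,[x,y]_{\mathfrak g}\rangle$; $\mathfrak{g}\ltimes_{\mathrm{ad}^{*}}\mathfrak g^{*}$ is $\mathfrak g\oplus\mathfrak g^*$ with $[x+a^*,y+b^*]=[x,y]_{\mathfrak g}+\mathrm{ad}^*(x)b^*-\mathrm{ad}^*(y)a^*$. $P^*,Q^*$ are transposes; a sum such as $P+Q^*$ of an operator on $\mathfrak g$ and one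 on $\mathfrak g^*$ denotes $x+a^*\mapsto P(x)+Q^*(a^* )$; $P$ (resp. $P^*$) alone is extended by zero on $\mathfrak g^*$ (resp. $\mathfrak g$). $P$ is identified with the element $\sum_iP(e_i)\otimes e_i^*\in\mathfrak g\otimes\mathfrak g^*\subseteq(\mathfrak{g}\ltimes_{\mathrm{ad}^{*}}\mathfrak g^{*})^{\otimes2}$, for a basis $\{e_i\}$ of $\mathfrak g$ with dual basis $\{e_i^*\}$, so $r=\sum_i(P(e_i)\otimes e_i^*-e_i^*\otimes P(e_i))$. An L-dendriform algebra $(A,\triangleright,\triangleleft)$ satisfies $(x\triangleright y)\triangleright z+(x\triangleleft y)\triangleright z+y\triangleright(x\triangleright z)-(y\triangleleft x)\triangleright z-(y\triangleright x)\triangleright z-x\triangleright(y\triangleright z)=0$ and $(x\triangleright y)\triangleleft z+y\triangleleft(x\triangleright z)+y\triangleleft(x\triangleleft z)-(y\triangleleft x)\triangleleft z-x\triangleright(y\triangleleft z)=0$; it is special if $\triangleleft$ is antisymmetric. A special L-dendriform coalgebra is $(A,\Delta,\nabla)$ with $\nabla=-\tau\nabla$ and, with $\Diamond=\Delta+\nabla$: $(\mathrm{id}\otimes\nabla)\nabla+(\tau\otimes\mathrm{id})(\mathrm{id}\otimes\Diamond)\nabla+(\Diamond\otimes\mathrm{id})\nabla-(\mathrm{id}\otimes\nabla)\Diamond=0$, $(\Diamond\otimes\mathrm{id})\Diamond-(\mathrm{id}\otimes\Diamond)\Diamond=(\tau\otimes\mathrm{id})(\Diamond\otimes\mathrm{id})\Diamond-(\tau\otimes\mathrm{id})(\mathrm{id}\otimes\Diamond)\Diamond$.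 A special L-dendriform bialgebra $(A,\triangleright,\triangleleft,\Delta,\nabla)$ consists of a special L-dendriform algebra and a special L-dendriform coalgebra such that, with $\Diamond=\Delta+\nabla$, $x\circ y=x\triangleright y+x\triangleleft y$, $[x,y]_\circ=x\circ y-y\circ x$, $\mathcal{L}_{\cdot}(x)y=x\cdot y$, $\mathcal{R}_{\cdot}(y)x=x\cdot y$, for all $x,y\in A$: $\Diamond(x\circ y)-(\mathrm{id}\otimes\mathcal{R}_{\circ}(y))\Delta(x)+(\mathcal{L}_{\triangleleft}(y)\otimes\mathrm{id})\nabla(x)-(\mathcal{L}_{\triangleright}(x)\otimes\mathrm{id}+\mathrm{id}\otimes\mathcal{L}_{\circ}(x))\Diamond(y)=0$, $(\tau-\mathrm{id})\big((\mathrm{id}\otimes\mathcal{L}_{\triangleleft}(x))\Diamond(y)-(\mathrm{id}\otimes\mathcal{L}_{\triangleleft}(y))\Diamond(x)-\Diamond(x\triangleleft y)\big)=0$, $\nabla([x,y]_\circ)+(\mathcal{L}_{\circ}(y)\otimes\mathrm{id}+\mathrm{id}\otimes\mathcal{L}_{\circ}(y))\nabla(x)-(\mathcal{L}_{\circ}(x)\otimes\mathrm{id}+\mathrm{id}\otimes\mathcal{L}_{\circ}(x))\nabla(y)=0$. *)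

(* Defs.v *)
From HB Require Import structures.
From mathcomp Require Import all_boot all_order all_algebra.

Set Implicit Arguments.
Unset Strict Implicit.
Unset Printing Implicit Defensive.

Import GRing.Theory.
Local Open Scope ring_scope.

(* Tensor products. An element of U (x) W is stored as its matrix of
   coordinates in the basis (e_i (x) f_j), where e and f are the library's
   bases of U and W. Every other operation is obtained from tlift, the
   extension of a bilinear map; tliftE and tens_decomp below are the universal
   property. *)
Section Tensor.
Variable K : fieldType.
Implicit Types U W X Y Z : vectType K.

Definition is_bilinear U W X (B : U -> W -> X) : Prop :=
  (forall u, linear (B u)) /\ (forall w, linear (B^~ w)).

Definition tens U W : vectType K := 'M[K]_(\dim {:U}, \dim {:W}).

Definition tpure U W (u : U) (w : W) : tens U W :=
  \matrix_(i, j) (coord (vbasis {:U}) i u * coord (vbasis {:W}) j w).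

Definition tlift U W X (B : U -> W -> X) (T : tens U W) : X :=
  \sum_i \sum_j
    (T : 'M[K]_(\dim {:U}, \dim {:W})) i j
      *: B (vbasis {:U})`_i (vbasis {:W})`_j.

Definition tmap U W X Y (f : U -> X) (g : W -> Y) : tens U W -> tens X Y :=
  tlift (fun u w => tpure (f u) (g w)).

Definition tflip U W : tens U W -> tens W U := tlift (fun u w => tpure w u).

(* The identification of U (x) (W (x) X) with (U (x) W) (x) X. *)
Definition tassoc U W X : tens U (tens W X) -> tens (tens U W) X :=
  tlift (fun u => tlift (fun w x => tpure (tpure u w) x)).

End Tensor.

Section TensorTheory.
Variable K : fieldType.
Implicit Types U W X Y Z : vectType K.

Lemma is_bilinear_sum U W X (B : U -> W -> X) I (r : seq I) a (u : I -> U)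
    J (s : seq J) b (w : J -> W) : is_bilinear B ->
  B (\sum_(i <- r) a i *: u i) (\sum_(j <- s) b j *: w j) =
  \sum_(i <- r) \sum_(j <- s) (a i * b j) *: B (u i) (w j).
Proof.
case=> linr linl.
have B0l v : B 0 v = 0.
  by have := linl v (-1) 0 0; rewrite /= scaler0 addr0 scaleN1r addNr.
have B0r v : B v 0 = 0.
  by have := linr v (-1) 0 0; rewrite scaler0 addr0 scaleN1r addNr.
elim: r => [|i r IHr]; first by rewrite !big_nil B0l.
rewrite !big_cons [LHS]linl IHr; congr (_ + _).
elim: s {IHr} => [|j s IHs]; first by rewrite !big_nil B0r scaler0.
by rewrite !big_cons linr scalerDr scalerA IHs.
Qed.

Lemma vbasis_decomp U (u : U) :
  u = \sum_i coord (vbasis {:U}) i u *: (vbasis {:U})`_i.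
Proof. exact: coord_vbasis (memvf u). Qed.

Lemma tliftE U W X (B : U -> W -> X) u w :
  is_bilinear B -> tlift B (tpure u w) = B u w.
Proof.
move=> bilB; rewrite [in RHS](vbasis_decomp u) [in RHS](vbasis_decomp w).
rewrite is_bilinear_sum //.
by apply: eq_bigr => i _; apply: eq_bigr => j _; rewrite mxE.
Qed.

Lemma tlift_linear U W X (B : U -> W -> X) : linear (tlift B).
Proof.
move=> a S T; rewrite /tlift scaler_sumr -big_split; apply: eq_bigr => i _.
rewrite scaler_sumr -big_split; apply: eq_bigr => j _ /=.
by rewrite scalerA -scalerDl !mxE.
Qed.

Lemma tpure_bilinear U W : is_bilinear (@tpure K U W).
Proof.
split=> v a x y; apply/matrixP=> i j; rewrite !mxE linearP /=.
  by rewrite mulrDr mulrCA.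
by rewrite mulrDl mulrA.
Qed.

Lemma tens_decomp U W (T : tens U W) : T = tlift (@tpure K U W) T.
Proof.
apply/matrixP=> i j; rewrite /tlift summxE (bigD1 i) //= summxE (bigD1 j) //=.
rewrite !mxE !coord_free ?(basis_free (vbasisP _)) // !eqxx !mulr1.
rewrite !big1 ?addr0 // => k ki.
  rewrite summxE big1 // => l _.
  rewrite !mxE !coord_free ?(basis_free (vbasisP _)) //.
  by move: ki; rewrite -val_eqE => /negbTE /= ->; rewrite mul0r mulr0.
rewrite !mxE !coord_free ?(basis_free (vbasisP _)) //.
by move: ki; rewrite -val_eqE => /negbTE /= ->; rewrite !mulr0.
Qed.

Lemma tmapE U W X Y (f : U -> X) (g : W -> Y) u w :
  linear f -> linear g -> tmap f g (tpure u w) = tpure (f u) (g w).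
Proof.
move=> linf ling; apply: tliftE; have [linr linl] := @tpure_bilinear X Y.
by split=> v a x y /=; rewrite ?ling ?linf ?linr //; apply: linl.
Qed.

Lemma tflipE U W (u : U) (w : W) : tflip (tpure u w) = tpure w u.
Proof.
apply: tliftE; have [linr linl] := @tpure_bilinear W U.
by split=> v a x y; [apply: linl | apply: linr].
Qed.

Lemma tassocE U W X (u : U) (w : W) (x : X) :
  tassoc (tpure u (tpure w x)) = tpure (tpure u w) x.
Proof.
have [linr linl] := @tpure_bilinear (tens U W) X.
have [linr' linl'] := @tpure_bilinear U W.
rewrite /tassoc tliftE.
  rewrite tliftE //; split=> v a y z; first exact: linr.
  by rewrite /= linr' linl.
split=> [v|t a y z]; first exact: tlift_linear.
rewrite /tlift scaler_sumr -big_split; apply: eq_bigr => i _.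
rewrite scaler_sumr -big_split; apply: eq_bigr => j _ /=.
by rewrite linl' linl scalerDr !scalerA [_ * a]mulrC.
Qed.

Lemma linfunE U W (f : U -> W) : linear f -> linfun f =1 f.
Proof.
move=> linf.
pose F := GRing.isLinear.Build K U W _ f linf.
pose L : {linear U -> W} := HB.pack f F.
exact: (lfunE L).
Qed.

End TensorTheory.

Section Algebras.
Variables (K : fieldType) (V : vectType K).

Record is_lie_bracket (br : V -> V -> V) : Prop := IsLieBracket {
  lie_bilinear : is_bilinear br;
  lie_alternating : forall x, br x x = 0;
  lie_jacobi : forall x y z,
    br x (br y z) + br y (br z x) + br z (br x y) = 0
}.

Record is_rota_baxter_lie (br : V -> V -> V) (P : 'End(V)) : Prop :=
  IsRotaBaxterLie {
  rb_lie : is_lie_bracket br;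
  rb_weight_zero : forall x y,
    br (P x) (P y) = P (br x (P y)) + P (br (P x) y)
}.

Definition admissible (br : V -> V -> V) (P Q : 'End(V)) : Prop :=
  forall x y, Q (br (P x) y) - br (P x) (Q y) - Q (br x (Q y)) = 0.

Record is_special_Ldendriform (rt lt : V -> V -> V) : Prop :=
  IsSpecialLdendriform {
  rt_bilinear : is_bilinear rt;
  lt_bilinear : is_bilinear lt;
  Ldendriform1 : forall x y z,
    rt (rt x y) z + rt (lt x y) z + rt y (rt x z)
      - rt (lt y x) z - rt (rt y x) z - rt x (rt y z) = 0;
  Ldendriform2 : forall x y z,
    lt (rt x y) z + lt y (rt x z) + lt y (lt x z)
      - lt (lt y x) z - rt x (lt y z) = 0;
  Ldendriform_special : forall x y, lt x y = - lt y x
}.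

Definition codiamond (Delta nabla : V -> tens V V) (a : V) : tens V V :=
  Delta a + nabla a.

(* id (x) f and f (x) id for f : V -> V (x) V, both with values in
   (V (x) V) (x) V. *)
Definition coext_r (f : V -> tens V V) (T : tens V V) : tens (tens V V) V :=
  tassoc (tmap id f T).
Definition coext_l (f : V -> tens V V) (T : tens V V) : tens (tens V V) V :=
  tmap f id T.

Definition tflip12 : tens (tens V V) V -> tens (tens V V) V :=
  tmap (@tflip K V V) id.

Record is_special_Ldendriform_coalg (Delta nabla : V -> tens V V) : Prop :=
  IsSpecialLdendriformCoalg {
  Delta_linear : linear Delta;
  nabla_linear : linear nabla;
  nabla_antisym : forall a, nabla a = - tflip (nabla a);
  Ldendriform_co1 : let dia := codiamond Delta nabla in forall a,
    coext_r nabla (nabla a) + tflip12 (coext_r dia (nabla a))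
      + coext_l dia (nabla a) - coext_r nabla (dia a) = 0;
  Ldendriform_co2 : let dia := codiamond Delta nabla in forall a,
    coext_l dia (dia a) - coext_r dia (dia a) =
    tflip12 (coext_l dia (dia a)) - tflip12 (coext_r dia (dia a))
}.

Definition ocirc (rt lt : V -> V -> V) (x y : V) : V := rt x y + lt x y.

Definition commutator (op : V -> V -> V) (x y : V) : V := op x y - op y x.

Definition Lmul (op : V -> V -> V) (x : V) : V -> V := fun y => op x y.
Definition Rmul (op : V -> V -> V) (y : V) : V -> V := fun x => op x y.

Record is_special_Ldendriform_bialg (rt lt : V -> V -> V)
    (Delta nabla : V -> tens V V) : Prop := IsSpecialLdendriformBialg {
  bialg_alg : is_special_Ldendriform rt lt;
  bialg_coalg : is_special_Ldendriform_coalg Delta nabla;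
  bialg_compat1 :
    let circ := ocirc rt lt in let dia := codiamond Delta nabla in
    forall x y,
    dia (circ x y) - tmap id (Rmul circ y) (Delta x)
      + tmap (Lmul lt y) id (nabla x)
      - (tmap (Lmul rt x) id (dia y) + tmap id (Lmul circ x) (dia y)) = 0;
  bialg_compat2 : let dia := codiamond Delta nabla in
    forall x y,
    let T := tmap id (Lmul lt x) (dia y) - tmap id (Lmul lt y) (dia x)
               - dia (lt x y) in
    tflip T - T = 0;
  bialg_compat3 : let circ := ocirc rt lt in
    forall x y,
    nabla (commutator circ x y)
      + (tmap (Lmul circ y) id (nabla x) + tmap id (Lmul circ y) (nabla x))
      - (tmap (Lmul circ x) id (nabla y) + tmap id (Lmul circ x) (nabla y)) = 0
}.

End Algebras.

Section Coadjoint.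
Variables (K : fieldType) (g : vectType K).

Definition dual : vectType K := 'Hom(g, K^o).

Definition transpose (f : 'End(g)) : 'End(dual) :=
  linfun (fun a : 'Hom(g, K^o) => (a \o f)%VF : 'Hom(g, K^o)).

Definition ad_star (br : g -> g -> g) (x : g) (a : dual) : dual :=
  linfun (fun y => - (a : 'Hom(g, K^o)) (br x y) : K^o).

(* The carrier of the semidirect product of g and its dual. *)
Definition gdual : vectType K := (g * dual)%type.

Definition semidirect_bracket (br : g -> g -> g) (a b : gdual) : gdual :=
  (br a.1 b.1, ad_star br a.1 b.2 - ad_star br b.1 a.2).

Definition opsum (S : 'End(g)) (T : 'End(dual)) (a : gdual) : gdual :=
  (S a.1, T a.2).

(* The element \sum_i f(e_i) (x) e_i^* of g (x) g^*, inside
   (g + g^* ) (x) (g + g^* ); see optens_basis for the independence of the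
   basis. *)
Definition optens (f : 'End(g)) : tens gdual gdual :=
  \sum_(i < \dim {:g})
    tpure ((f (vbasis {:g})`_i, 0) : gdual)
          ((0, linfun (coord (vbasis {:g}) i : g -> K^o)) : gdual).

Definition rmatrix (P : 'End(g)) : tens gdual gdual :=
  optens P - tflip (optens P).

Definition cobracket (br : gdual -> gdual -> gdual) (r : tens gdual gdual)
    (a : gdual) : tens gdual gdual :=
  tmap (br a) id r + tmap id (br a) r.

Lemma transposeE (f : 'End(g)) (a : 'Hom(g, K^o)) (x : g) :
  (transpose f a : 'Hom(g, K^o)) x = a (f x).
Proof.
have lin : linear (fun b : 'Hom(g, K^o) => (b \o f)%VF : 'Hom(g, K^o)).
  by move=> c b b'; rewrite comp_lfunDl comp_lfunZl.
by rewrite /transpose (linfunE lin) comp_lfunE.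
Qed.

Lemma ad_starE (br : g -> g -> g) (x : g) (a : 'Hom(g, K^o)) (y : g) :
  is_bilinear br ->
  (ad_star br x a : 'Hom(g, K^o)) y = - a (br x y).
Proof.
case=> linr _.
have lin : linear (fun y => - a (br x y) : K^o).
  by move=> c z t; rewrite linr linearP opprD scalerN.
by rewrite /ad_star (linfunE lin).
Qed.

Lemma optens_basis (f : 'End(g)) n (e : n.-tuple g) : basis_of {:g} e ->
  optens f = \sum_(i < n)
    tpure ((f e`_i, 0) : gdual)
          ((0, linfun (coord e i : g -> K^o)) : gdual).
Proof.
move=> be.
pose B (x : g) (a : dual) := tpure ((f x, 0) : gdual) ((0, a) : gdual).
have bilB : is_bilinear B.
  have [linr linl] := @tpure_bilinear K gdual gdual.
  split=> [x c a b|a c x y]; rewrite /B.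
    rewrite -linr; congr tpure.
    by congr pair; rewrite /= scaler0 addr0.
  rewrite -[RHS]linl; congr tpure.
  by rewrite linearP; congr pair; rewrite /= scaler0 addr0.
rewrite /optens -/(B _ _).
have dec (i : 'I_(\dim {:g})) : linfun (coord (vbasis {:g}) i : g -> K^o) =
    \sum_(j < n) coord (vbasis {:g}) i e`_j *: linfun (coord e j : g -> K^o).
  apply/lfunP=> x; rewrite sum_lfunE lfunE /=.
  rewrite {1}(coord_basis be (memvf x)) linear_sum /=.
  apply: eq_bigr => j _; rewrite linearZ /= scale_lfunE lfunE /=.
  by rewrite [LHS]mulrC.
transitivity (\sum_i \sum_(j < n) coord (vbasis {:g}) i e`_j *:
    B (vbasis {:g})`_i (linfun (coord e j : g -> K^o))).
  apply: eq_bigr => i _; rewrite [X in tpure _ (_, X)]dec -/(B _ _).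
  have := is_bilinear_sum [:: i] (fun=> 1) (fun k => (vbasis {:g})`_k)
    (index_enum 'I_n) (fun j => coord (vbasis {:g}) i e`_j)
    (fun j => linfun (coord e j : g -> K^o)) bilB.
  rewrite !big_seq1 scale1r => ->.
  by apply: eq_bigr => j _; rewrite mul1r.
rewrite exchange_big; apply: eq_bigr => j _ /=.
have := is_bilinear_sum (index_enum 'I_(\dim {:g}))
  (fun i => coord (vbasis {:g}) i e`_j) (fun i => (vbasis {:g})`_i)
  [:: j] (fun=> 1) (fun k => linfun (coord e k : g -> K^o)) bilB.
rewrite big_seq1 scale1r -vbasis_decomp => h; rewrite -/(B _ _) h.
by apply: eq_bigr => i _; rewrite big_seq1 mulr1.
Qed.

End Coadjoint.

(* Main.v *)
Require Import Defs.
From HB Require Import structures.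
From mathcomp Require Import all_boot all_order all_algebra.
From mathcomp Require Import ring.

(* The double [D = g (+) g^*] carries the invariant form
   [<x + a^*, y + b^*> = a^*(y) + b^*(x)]. For it [Q + P^*] is the adjoint of
   [PP := P + Q^*], and admissibility of [Q] makes [PP] a Rota-Baxter operator
   on [D]; a Rota-Baxter operator and its adjoint yield a
   special L-dendriform structure. Contraction with the form turns [r] into the
   skew operator [R := P - P^*], again Rota-Baxter (the case [Q = - P]), which
   commutes with [PP] because [P] commutes with [Q]. Then
   [<delta a, c (x) d> = - <a, [R c, d] + [c, R d]>], so the coalgebra axioms
   are the algebra axioms for the Lie bracket [- ([R c, d] + [c, R d])], for
   which [PP] is still Rota-Baxter with adjoint [Q + P^*], and the three
   compatibilities reduce to the 1-cocycle identity of the coboundary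
   [delta]. *)

Set Implicit Arguments.
Unset Strict Implicit.
Unset Printing Implicit Defensive.

Import GRing.Theory.
Local Open Scope ring_scope.

(** * Bilinear maps, and linear maps on tensor products *)

Section BilinearTheory.
Variables (K : fieldType) (U W X : vectType K).

Section Expansion.
Variables (B : U -> W -> X) (bilB : is_bilinear B).

Lemma bilinearDr u w w' : B u (w + w') = B u w + B u w'.
Proof. by have := bilB.1 u 1 w w'; rewrite !scale1r. Qed.

Lemma bilinearDl u u' w : B (u + u') w = B u w + B u' w.
Proof. by have := bilB.2 w 1 u u'; rewrite /= !scale1r. Qed.

Lemma bilinear0r u : B u 0 = 0.
Proof. by apply: (addIr (B u 0)); rewrite -bilinearDr !add0r. Qed.

Lemma bilinear0l w : B 0 w = 0.
Proof. by apply: (addIr (B 0 w)); rewrite -bilinearDl !add0r. Qed.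

Lemma bilinearNr u w : B u (- w) = - B u w.
Proof. by apply: (addIr (B u w)); rewrite -bilinearDr !addNr bilinear0r. Qed.

Lemma bilinearNl u w : B (- u) w = - B u w.
Proof. by apply: (addIr (B u w)); rewrite -bilinearDl !addNr bilinear0l. Qed.

Lemma bilinearZr a u w : B u (a *: w) = a *: B u w.
Proof. by have := bilB.1 u a w 0; rewrite !addr0 bilinear0r addr0. Qed.

Lemma bilinearZl a u w : B (a *: u) w = a *: B u w.
Proof. by have := bilB.2 w a u 0; rewrite /= !addr0 bilinear0l addr0. Qed.

Definition bilinearE := (bilinearDr, bilinearDl, bilinearNr, bilinearNl).

Lemma bilinear_comp (f : {linear U -> U}) (g : {linear W -> W}) :
  is_bilinear (fun u w => B (f u) (g w)).
Proof.
by split=> v a x y /=; rewrite linearP ?bilinearDr ?bilinearDl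
  ?bilinearZr ?bilinearZl.
Qed.

Lemma bilinear_postcomp (f : {linear X -> X}) :
  is_bilinear (fun u w => f (B u w)).
Proof.
by split=> v a x y /=; rewrite ?bilinearDr ?bilinearDl ?bilinearZr
  ?bilinearZl linearP.
Qed.

Lemma bilinear_opp : is_bilinear (fun u w => - B u w).
Proof.
by split=> v a x y /=; rewrite ?bilinearDr ?bilinearDl ?bilinearZr
  ?bilinearZl opprD scalerN.
Qed.

End Expansion.

Lemma bilinear_add (B C : U -> W -> X) :
  is_bilinear B -> is_bilinear C -> is_bilinear (fun u w => B u w + C u w).
Proof.
move=> bilB bilC; split=> v a x y /=.
  by rewrite !bilinearDr // !bilinearZr // scalerDr addrACA.
by rewrite !bilinearDl // !bilinearZl // scalerDr addrACA.
Qed.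

(** Pure tensors span, by [tens_decomp]. *)
Lemma tens_ext (F G : tens U W -> X) : linear F -> linear G ->
  (forall u w, F (tpure u w) = G (tpure u w)) -> F =1 G.
Proof.
move=> linF linG FG T.
pose mF := GRing.isLinear.Build K (tens U W) X _ F linF.
pose mG := GRing.isLinear.Build K (tens U W) X _ G linG.
pose F' : {linear _ -> _} := HB.pack F mF.
pose G' : {linear _ -> _} := HB.pack G mG.
rewrite -[F]/(F' : _ -> _) -[G]/(G' : _ -> _) (tens_decomp T) !linear_sum.
apply: eq_bigr => i _; rewrite !linear_sum; apply: eq_bigr => j _.
by rewrite !linearZ /= FG.
Qed.

Lemma linear_funcomp (f : W -> X) (h : U -> W) :
  linear f -> linear h -> linear (fun x => f (h x)).
Proof. by move=> linf linh a x y; rewrite linh linf. Qed.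

End BilinearTheory.

(** Coordinates are linear functionals. Testing against functionals turns vector identities into
    scalar ones, on which [ring] can work. *)
Lemma linear_functional_eq (K : fieldType) (V : vectType K) (u v : V) :
  (forall f : {linear V -> K^o}, f u = f v) -> u = v.
Proof.
move=> uv; rewrite (vbasis_decomp u) (vbasis_decomp v).
by apply: eq_bigr => i _; rewrite uv.
Qed.

Definition linear_distrE (K : fieldType) (U W : vectType K)
    (f : {linear U -> W}) :
    (forall x y, f (x + y) = f x + f y) * (forall x, f (- x) = - f x)
    * (f 0 = 0) :=
  (linearD f, linearN f, linear0 f).

(** * Rota-Baxter operators on a Lie algebra *)

Section Lie.
Variables (K : fieldType) (V : vectType K) (br : V -> V -> V).
Hypothesis lie_br : is_lie_bracket br.
Let bilb : is_bilinear br := lie_bilinear lie_br.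

Lemma lie_anti x y : br x y = - br y x.
Proof.
apply/eqP; rewrite -addr_eq0; apply/eqP.
have := lie_alternating lie_br (x + y).
by rewrite !(bilinearE bilb) !(lie_alternating lie_br) add0r addr0 addrC.
Qed.

Lemma lie_derivation x y z :
  br x (br y z) = br (br x y) z + br y (br x z).
Proof.
have := lie_jacobi lie_br x y z.
rewrite (lie_anti z (br x y)) (lie_anti z x) (bilinearNr bilb) => /eqP.
by rewrite -addrA -opprD subr_eq0 => /eqP ->; rewrite addrC.
Qed.

Variables P Q : {linear V -> V}.
Hypothesis rbP :
  forall x y, br (P x) (P y) = P (br x (P y)) + P (br (P x) y).

(** The two products add up to [br (P a) b], and the first axiom says that the left multiplications
    of the first product represent the commutator of this sum. Both axioms follow from Jacobi once
    nested operators are eliminated. *)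
Lemma rota_baxter_Ldendriform :
  (forall x y, Q (br (P x) y) = br (P x) (Q y) + Q (br x (Q y))) ->
  is_special_Ldendriform (fun a b => br (P a) b + Q (br a b))
                         (fun a b => - Q (br a b)).
Proof.
move=> admQ.
have bilQ := bilinear_postcomp bilb Q.
have bilP : is_bilinear (fun x y => br (P x) y) := bilinear_comp bilb P idfun.
(* Admissibility solved for the term in which [Q] occurs twice, which iterated products produce. *)
have admr x y : Q (br x (Q y)) = Q (br (P x) y) - br (P x) (Q y).
  by rewrite admQ addrC addKr.
have rbr u x y : br (br (P x) (P y)) u
    = br (P (br x (P y))) u + br (P (br (P x) y)) u.
  by rewrite rbP (bilinearDl bilb).
split.
- exact: bilinear_add.
- exact: bilinear_opp.
- move=> x y z; apply: linear_functional_eq => f.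
  have E := (bilinearE bilb, linear_distrE f, linear_distrE Q, linear_distrE P).
  rewrite !E !admr (lie_derivation (P x) (P y) z) (lie_derivation (P x) y z).
  rewrite (lie_derivation x (P y) z) rbr !E.
  rewrite (lie_anti (P y) x) (lie_anti y x) !E.
  ring.
- move=> x y z; apply: linear_functional_eq => f.
  have E := (bilinearE bilb, linear_distrE f, linear_distrE Q, linear_distrE P).
  rewrite !E !admr (lie_derivation (P x) y z) (lie_anti y x) !E.
  ring.
- by move=> x y; rewrite lie_anti (linearN Q).
Qed.

(* The terms with [P] inside both brackets regroup into three Jacobi sums. *)
Lemma rota_baxter_descendent_lie :
  is_lie_bracket (fun x y => - (br (P x) y + br x (P y))).
Proof.
split.
- apply/bilinear_opp/bilinear_add.
    exact: (bilinear_comp bilb P idfun).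
  exact: (bilinear_comp bilb idfun P).
- by move=> x; rewrite (lie_anti x) subrr oppr0.
- move=> x y z; apply: linear_functional_eq => f.
  have E := (bilinearE bilb, linear_distrE f, linear_distrE P).
  (* With the Rota-Baxter identity solved for this term, all terms with [P] of a bracket cancel. *)
  have rbr u v w : br u (P (br (P v) w))
      = br u (br (P v) (P w)) - br u (P (br v (P w))).
    by rewrite rbP !E addrAC subrr add0r.
  have jac u v w : br u (br v w) = - br v (br w u) - br w (br u v).
    apply/eqP; rewrite -opprD -addr_eq0 addrA.
    exact/eqP/(lie_jacobi lie_br).
  rewrite !E !rbr (jac (P x) (P y) z) (jac (P y) (P z) x) (jac (P z) (P x) y).
  rewrite !E; ring.
Qed.

End Lie.

Lemma tmap_linear (K : fieldType) (U W X Y : vectType K) (f : U -> X)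
  (h : W -> Y) : linear (tmap f h).
Proof. exact: tlift_linear. Qed.

(** * Tensors paired through a nondegenerate symmetric form *)

Section Duality.
Variables (K : fieldType) (V : vectType K) (form : V -> V -> K^o).
Hypothesis bilf : is_bilinear form.
Hypothesis form_sym : forall x y, form x y = form y x.
(** Nondegeneracy as representability: coordinate functionals are then realised by pairing with a
    vector. *)
Hypothesis form_represents :
  forall f : {linear V -> K^o}, exists c, forall x, form x c = f x.

Lemma form_inj u v : (forall c, form u c = form v c) -> u = v.
Proof.
by move=> uv; apply: linear_functional_eq => f;
  have [c fc] := form_represents f; rewrite -!fc.
Qed.

Section Contraction.
Variable U : vectType K.

(** The first factor is an arbitrary [U] so that triple tensors can be contracted too, with [U] a
    tensor square. *)
Definition contract (c : V) : tens U V -> U :=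
  tlift (fun u w => form w c *: u).

Lemma contract_tpure c u w : contract c (tpure u w) = form w c *: u.
Proof.
apply: tliftE; split=> v a x y /=.
  by rewrite (bilinearDl bilf) (bilinearZl bilf) scalerDl scalerA.
by rewrite scalerDr !scalerA mulrC.
Qed.

Lemma contract_linear c : linear (contract c).
Proof. exact: tlift_linear. Qed.

(** For [c] representing coordinate [j], coordinate [i] of the contraction is the matrix entry at
    [i], [j]. *)
Lemma contract_inj (T S : tens U V) :
  (forall c, contract c T = contract c S) -> T = S.
Proof.
move=> TS; apply/matrixP=> i j.
have [c fc] := form_represents (coord (vbasis {:V}) j).
have contrE T' : coord (vbasis {:U}) i (contract c T') = T' i j.
  rewrite /contract /tlift linear_sum (bigD1 i) //= linear_sum (bigD1 j) //=.
  rewrite !linearZ /= fc /= !coord_free ?(basis_free (vbasisP _)) // !eqxx.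
  rewrite /GRing.scale /= !mulr1.
  rewrite !big1 ?addr0 // => k ki.
    rewrite linear_sum big1 // => l _.
    rewrite !linearZ /= coord_free ?(basis_free (vbasisP _)) //.
    by move: ki; rewrite -val_eqE => /negbTE /= ->; rewrite !mulr0.
  rewrite !linearZ /= fc /= coord_free ?(basis_free (vbasisP _)) //.
  by move: ki; rewrite -val_eqE => /negbTE /= ->; rewrite mul0r mulr0.
by rewrite -!contrE TS.
Qed.

End Contraction.

Lemma contract_tmap (U X : vectType K) c (f : U -> X) (h h' : V -> V)
    (T : tens U V) :
  linear f -> linear h -> (forall x y, form (h x) y = form x (h' y)) ->
  contract c (tmap f h T) = f (contract (h' c) T).
Proof.
move=> linf linh adjh.
apply: (tens_ext (F := fun T => contract c (tmap f h T))
  (G := fun T => f (contract (h' c) T))).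
- exact: linear_funcomp (contract_linear _) (@tlift_linear _ _ _ _ _).
- exact: linear_funcomp linf (contract_linear _).
move=> u w; rewrite tmapE // !contract_tpure adjh.
pose mf := GRing.isLinear.Build K U X _ f linf.
pose f' : {linear _ -> _} := HB.pack f mf.
by rewrite -[f]/(f' : _ -> _) linearZ.
Qed.

(** The form induced on the tensor square, evaluated against [c (x) d]. Triple tensors are paired as
    [pairing (contract e _) c d]. *)
Definition pairing (T : tens V V) (c d : V) : K^o := form (contract d T) c.

Lemma pairing_linear c d : linear (fun T => pairing T c d).
Proof. by move=> a T S; rewrite /pairing contract_linear bilf.2. Qed.

Lemma pairingD T S c d : pairing (T + S) c d = pairing T c d + pairing S c d.
Proof. by have := pairing_linear c d 1 T S; rewrite !scale1r. Qed.

Lemma pairing0 c d : pairing 0 c d = 0.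
Proof. by apply: (addIr (pairing 0 c d)); rewrite -pairingD !add0r. Qed.

Lemma pairingN T c d : pairing (- T) c d = - pairing T c d.
Proof.
by apply: (addIr (pairing T c d)); rewrite -pairingD !addNr pairing0.
Qed.

Lemma pairingZ a T c d : pairing (a *: T) c d = a *: pairing T c d.
Proof. by have := pairing_linear c d a T 0; rewrite !addr0 pairing0 addr0. Qed.

Definition pairingE := (pairingD, pairingN, pairing0).

Lemma pairing_inj T S :
  (forall c d, pairing T c d = pairing S c d) -> T = S.
Proof.
by move=> TS; apply: contract_inj => d; apply: form_inj => c; apply: TS.
Qed.

Lemma pairing_tpure u w c d : pairing (tpure u w) c d = form u c * form w d.
Proof. by rewrite /pairing contract_tpure (bilinearZl bilf) mulrC. Qed.

Lemma pairing_tflip T c d : pairing (tflip T) c d = pairing T d c.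
Proof.
apply: (tens_ext (F := fun T => pairing (tflip T) c d)
  (G := fun T => pairing T d c)); last first.
- by move=> u w; rewrite tflipE !pairing_tpure mulrC.
- exact: pairing_linear.
- exact: (linear_funcomp (pairing_linear c d) (@tlift_linear _ _ _ _ _)).
Qed.

Lemma pairing_tmap (f f' h h' : V -> V) T c d :
  linear f -> linear h ->
  (forall x y, form (f x) y = form x (f' y)) ->
  (forall x y, form (h x) y = form x (h' y)) ->
  pairing (tmap f h T) c d = pairing T (f' c) (h' d).
Proof.
move=> linf linh adjf adjh.
by rewrite /pairing (contract_tmap d T linf linh adjh) adjf.
Qed.

Section Dualization.
Variables (m : V -> V -> V) (Gamma : V -> tens V V).
Hypothesis linG : linear Gamma.
Hypothesis pairG : forall a c d, pairing (Gamma a) c d = form a (m c d).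

Lemma pairing_coext_l T c d e :
  pairing (contract e (coext_l Gamma T)) c d = pairing T (m c d) e.
Proof. by rewrite (@contract_tmap _ _ _ _ _ id). Qed.

(** [tassoc] is computed on pure tensors, hence two reductions: first for [T], then for the value of
    [Gamma] on its second factor. *)
Lemma pairing_coext_r T c d e :
  pairing (contract e (coext_r Gamma T)) c d = pairing T c (m d e).
Proof.
apply: (tens_ext (F := fun T => pairing (contract e (coext_r Gamma T)) c d)
  (G := fun T => pairing T c (m d e))); last first.
- move=> u w; rewrite /coext_r tmapE // pairing_tpure -pairG.
  apply: (tens_ext
    (F := fun t => pairing (contract e (tassoc (tpure u t))) c d)
    (G := fun t => form u c * pairing t d e)).
  + apply: (linear_funcomp (pairing_linear c d)).
    apply: (linear_funcomp (contract_linear e)).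
    apply: (linear_funcomp (@tlift_linear _ _ _ _ _)).
    exact: (tpure_bilinear _ _).1.
  + by move=> a t s; rewrite pairing_linear mulrDr /GRing.scale /= mulrCA.
  + move=> v x; rewrite tassocE contract_tpure.
    by rewrite pairingZ !pairing_tpure /GRing.scale /= mulrC -mulrA.
- exact: pairing_linear.
- apply: (linear_funcomp (pairing_linear c d)).
  apply: (linear_funcomp (contract_linear e)).
  exact: (linear_funcomp (@tlift_linear _ _ _ _ _) (@tlift_linear _ _ _ _ _)).
Qed.

End Dualization.

Lemma pairing_tflip12 S c d e :
  pairing (contract e (tflip12 S)) c d = pairing (contract e S) d c.
Proof.
rewrite /tflip12 (@contract_tmap _ _ _ _ _ id) ?pairing_tflip //.
exact: tlift_linear.
Qed.

(** [Delta] and [nabla] are the transposes of [rt] and [lt], so a coalgebra identity at [a], paired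
    with [c], [d], [e], becomes [form a] of an algebra identity. *)
Lemma special_Ldendriform_dual (rt lt : V -> V -> V)
    (Delta nabla : V -> tens V V) :
  is_special_Ldendriform rt lt -> linear Delta -> linear nabla ->
  (forall a c d, pairing (Delta a) c d = form a (rt c d)) ->
  (forall a c d, pairing (nabla a) c d = form a (lt c d)) ->
  is_special_Ldendriform_coalg Delta nabla.
Proof.
move=> [bilr bill ax1 ax2 anti] linD linN pairD pairN.
have pairC a c d : pairing (codiamond Delta nabla a) c d
    = form a (rt c d + lt c d).
  by rewrite pairingD pairD pairN (bilinearDr bilf).
have linC : linear (codiamond Delta nabla).
  by move=> a x y; rewrite /codiamond linD linN addrACA -scalerDr.
have cD e T S : contract e (T + S) = contract e T + contract e S :> tens V V.
  by have := contract_linear e 1 T S; rewrite !scale1r.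
have c0 e : contract e 0 = 0 :> tens V V.
  by apply: (addIr (contract e 0)); rewrite -cD !add0r.
have cN e T : contract e (- T) = - contract e T :> tens V V.
  by apply: (addIr (contract e T)); rewrite -cD !addNr c0.
have coE := (pairing_tflip12, pairing_coext_l linD pairD,
  pairing_coext_l linN pairN, pairing_coext_l linC pairC,
  pairing_coext_r linD pairD,
  pairing_coext_r linN pairN, pairing_coext_r linC pairC).
have E := (bilinearE bilf, bilinearE bilr, bilinearE bill, bilinear0r bilf).
split=> //.
- move=> a; apply: pairing_inj => c d.
  by rewrite pairingN pairing_tflip !pairN anti (bilinearNr bilf).
- move=> dia a; apply: contract_inj => e; apply: pairing_inj => c d.
  rewrite !(cD, cN, c0) !pairingE !coE !pairN pairC.
  (* The first coalgebra axiom transposes to the second algebra axiom, once specialness replaces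
     [lt d c] by [- lt c d] and the two copies of [lt c (lt d e)] cancel. *)
  have := congr1 (form a) (ax2 c d e).
  by rewrite (anti d c) !E => h; rewrite -[RHS]h; ring.
- move=> dia a; apply: contract_inj => e; apply: pairing_inj => c d.
  rewrite !(cD, cN, c0) !pairingE !coE !pairC.
  (* The pre-Lie identity is the sum of both L-dendriform axioms, the second
     one antisymmetrized in [c] and [d]. *)
  have comb u v w : u = 0 -> v = 0 -> w = 0 -> form a (u + v - w) = 0.
    by move=> -> -> ->; rewrite addr0 subr0 (bilinear0r bilf).
  have := comb _ _ _ (ax1 c d e) (ax2 c d e) (ax2 d c e).
  rewrite !E => h; apply/eqP; rewrite -subr_eq0 -h; apply/eqP; ring.
Qed.

(** * The bialgebra of a quadratic Lie algebra with commuting Rota-Baxter operators *)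

Section Bialgebra.
Variables (br : V -> V -> V) (P Q R : {linear V -> V}) (r : tens V V).
Hypothesis lie_br : is_lie_bracket br.
Hypothesis form_inv : forall x y z, form (br x y) z = form x (br y z).
Hypothesis rbP :
  forall x y, br (P x) (P y) = P (br x (P y)) + P (br (P x) y).
Hypothesis rbR :
  forall x y, br (R x) (R y) = R (br x (R y)) + R (br (R x) y).
Hypothesis adjQ : forall x y, form (Q x) y = form x (P y).
Hypothesis skewR : forall x y, form (R x) y = - form x (R y).
Hypothesis PR : forall x, P (R x) = R (P x).
Hypothesis contract_r : forall d, contract d r = R d.

Let brR x y := br (R x) y + br x (R y).
Let delta a := tmap (br a) id r + tmap id (br a) r.

(** Paired with [c], each [Q] becomes a [P], and what results is the Rota-Baxter identity of [P] at
    [x] and [c]. *)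
Lemma adjoint_admissible x y : Q (br (P x) y) = br (P x) (Q y) + Q (br x (Q y)).
Proof.
apply: form_inj => c.
rewrite (bilinearDl bilf) !adjQ.
rewrite (lie_anti lie_br (P x) y) (lie_anti lie_br (P x) (Q y)).
rewrite (lie_anti lie_br x (Q y)) !(bilinearNl bilf) !form_inv !adjQ.
by rewrite rbP (bilinearDr bilf) opprD addrC.
Qed.

(** [br a] is skew for the invariant form, so it moves from the legs of [r] to [c] and [d].
    Contracting [r] then gives [R], and skewness of [R] with invariance isolates [a]. *)
Lemma pairing_delta a c d : pairing (delta a) c d = - form a (brR c d).
Proof.
have bil := lie_bilinear lie_br.
have ad_skew x y : form (br a x) y = form x (- br a y).
  by rewrite (lie_anti lie_br) (bilinearNl bilf) form_inv (bilinearNr bilf).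
rewrite /delta pairingD.
rewrite (@pairing_tmap (br a) (fun c => - br a c) id id) //; last exact: bil.1.
rewrite (@pairing_tmap id id (br a) (fun c => - br a c)) //; last exact: bil.1.
rewrite /pairing !contract_r !(linear_distrE R) !(bilinearE bilf).
rewrite (form_sym (R d)) (skewR (br a d)) !form_inv.
by rewrite (lie_anti lie_br d) (bilinearNr bilf) opprK -opprD addrC.
Qed.

Lemma delta_linear : linear delta.
Proof.
move=> k x y; apply: pairing_inj => c d.
by rewrite [RHS]pairingD pairingZ !pairing_delta bilf.2 opprD scalerN.
Qed.

(* [delta] is a coboundary, hence a 1-cocycle. *)
Lemma delta_cocycle x y c d :
  form (br x y) (brR c d) = form x (brR c (br y d)) + form x (brR (br y c) d)
    - form y (brR c (br x d)) - form y (brR (br x c) d).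
Proof.
have bil := lie_bilinear lie_br.
(* Invariance exchanges the two outer vectors. With [swapR] the terms containing [R] of a bracket
   cancel in pairs; the rest is Jacobi. *)
have swap u v w z : form v (br u (br w z)) = form w (br z (br v u)).
  by rewrite -form_inv form_sym form_inv.
have swapR u v w z : form u (br v (R (br w z))) = form w (br (R (br u v)) z).
  rewrite -form_inv -[LHS]opprK -skewR form_sym form_inv -(bilinearNr bilf).
  by rewrite -(lie_anti lie_br).
rewrite form_inv /brR !(bilinearE bil) !(bilinearE bilf) !swapR.
rewrite (swap (R c) y x d) (lie_anti lie_br (br x c)) (bilinearNr bilf).
rewrite (swap (R d) y x c) (lie_derivation lie_br y (R c)).
rewrite (lie_derivation lie_br y c) (lie_anti lie_br d) !(bilinearE bilf); ring.
Qed.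

(** Every axiom on tensors is tested against the form. Since [P] commutes with [R], the Rota-Baxter
    and admissibility identities carry over from [br] to [brR], where the coalgebra axioms and the
    first two compatibilities need them. *)
Lemma quadratic_rota_baxter_bialg :
  is_special_Ldendriform_bialg
    (fun a b => br (P a) b + Q (br a b)) (fun a b => - Q (br a b))
    (fun a => tmap Q id (delta a) + delta (P a)) (fun a => - delta (P a)).
Proof.
have bil := lie_bilinear lie_br.
have bilR : is_bilinear brR.
  exact: bilinear_add (bilinear_comp bil R idfun) (bilinear_comp bil idfun R).
have brR_anti x y : brR x y = - brR y x.
  by rewrite /brR opprD -!(lie_anti lie_br) addrC.
have rbPR x y : brR (P x) (P y) = P (brR x (P y)) + P (brR (P x) y).
  by rewrite /brR -!PR !rbP !(linear_distrE P) addrACA.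
have QR x : Q (R x) = R (Q x).
  by apply: form_inj => c; rewrite adjQ !skewR adjQ PR.
have admR x y : Q (brR (P x) y) = brR (P x) (Q y) + Q (brR x (Q y)).
  rewrite /brR -!PR !(linear_distrE Q) !adjoint_admissible -QR.
  exact: addrACA.
have adjP x y : form (P x) y = form x (Q y) by rewrite form_sym -adjQ form_sym.
have alg := rota_baxter_Ldendriform lie_br rbP adjoint_admissible.
set rt := fun a b => br (P a) b + Q (br a b) in alg *.
set lt := fun a b => - Q (br a b) in alg *.
(* The terms in [Q] cancel, leaving the pre-Lie product of the Rota-Baxter operator [P]. *)
have circE a b : ocirc rt lt a b = br (P a) b by rewrite /ocirc addrK.
set Delta := fun a => _ : tens V V; set nabla := fun a => - delta (P a).
have pairN a c d : pairing (nabla a) c d = form (P a) (brR c d).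
  by rewrite pairingN pairing_delta opprK.
(* Likewise [delta (P a)] cancels, and the sum is [(Q (x) id) (delta a)]. *)
have pairC a c d : pairing (codiamond Delta nabla a) c d
    = - form a (brR (P c) d).
  rewrite /codiamond /Delta /nabla addrK.
  rewrite (@pairing_tmap Q P id id) ?pairing_delta //.
  exact: linearP.
have pairD a c d : pairing (Delta a) c d
    = - form a (brR (P c) d) - form (P a) (brR c d).
  by rewrite -pairC -pairN -pairingN -pairingD /codiamond addrK.
have linQ : linear Q by exact: linearP.
have linnabla : linear nabla.
  by move=> k x y; rewrite /nabla linearP delta_linear opprD scalerN.
have linDelta : linear Delta.
  move=> k x y; rewrite /Delta !delta_linear linearP delta_linear tmap_linear.
  by rewrite addrACA -scalerDr.
have bilrt := rt_bilinear alg; have billt := lt_bilinear alg.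
have adjbr a x y : form (br a x) y = form x (- br a y).
  by rewrite (lie_anti lie_br) (bilinearNl bilf) form_inv (bilinearNr bilf).
have PN : forall x, P (- x) = - P x := linearN P.
have QN : forall x, Q (- x) = - Q x := linearN Q.
have E := (bilinearNr bilf, bilinearNl bilf, bilinearNl bilR, bilinearNr bilR,
  PN, QN).
have bilcirc : is_bilinear (ocirc rt lt) := bilinear_add bilrt billt.
(* Adjoints of the multiplications; they carry these maps from the legs of a tensor to [c] and
   [d]. *)
have adjlt x z y : form (lt x z) y = form z (br x (P y)).
  by rewrite /lt E adjQ adjbr !E opprK.
have adjcircl x z y : form (ocirc rt lt x z) y = form z (- br (P x) y).
  by rewrite circE adjbr.
have pairR y T c d :
    pairing (tmap id (Rmul (ocirc rt lt) y) T) c d = pairing T c (Q (br y d)).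
  apply: (pairing_tmap (f' := id) (h' := fun d => Q (br y d))) => //.
    exact: bilcirc.2.
  by move=> x z; rewrite /Rmul circE form_inv adjP.
have pairlt_l y T c d :
    pairing (tmap (Lmul lt y) id T) c d = pairing T (br y (P c)) d.
  apply: (pairing_tmap (f' := fun c => br y (P c)) (h' := id)) => //.
  exact: billt.1.
have pairlt_r y T c d :
    pairing (tmap id (Lmul lt y) T) c d = pairing T c (br y (P d)).
  apply: (pairing_tmap (f' := id) (h' := fun c => br y (P c))) => //.
  exact: billt.1.
have pairrt x T c d : pairing (tmap (Lmul rt x) id T) c d
    = pairing T (- (br (P x) c + br x (P c))) d.
  apply: (pairing_tmap (f' := fun c => - (br (P x) c + br x (P c)))
    (h' := id)) => //; first exact: bilrt.1.
  move=> z y; rewrite /Lmul /rt (bilinearDl bilf) adjQ !adjbr.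
  by rewrite -(bilinearDr bilf) opprD.
have paircirc_l x T c d : pairing (tmap (Lmul (ocirc rt lt) x) id T) c d
    = pairing T (- br (P x) c) d.
  apply: (pairing_tmap (f' := fun c => - br (P x) c) (h' := id)) => //.
    exact: bilcirc.1.
  exact: adjcircl.
have paircirc_r x T c d : pairing (tmap id (Lmul (ocirc rt lt) x) T) c d
    = pairing T c (- br (P x) d).
  apply: (pairing_tmap (f' := id) (h' := fun c => - br (P x) c)) => //.
    exact: bilcirc.1.
  exact: adjcircl.
have lieR : is_lie_bracket (fun x y => - brR x y)
  := rota_baxter_descendent_lie lie_br rbR.
have coc := delta_cocycle.
clearbody Delta nabla brR delta.
split=> //.
(* The sign is that of [pairing_delta]: the L-dendriform products of [P] and [Q] over [brR'] have
   [Delta] and [nabla] as transposes. *)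
- pose brR' x y := - brR x y.
  have rbPR' x y : brR' (P x) (P y) = P (brR' x (P y)) + P (brR' (P x) y).
    by rewrite /brR' !PN rbPR opprD.
  have admR' x y : Q (brR' (P x) y) = brR' (P x) (Q y) + Q (brR' x (Q y)).
    by rewrite /brR' !QN admR opprD.
  have algR := rota_baxter_Ldendriform lieR rbPR' admR'.
  apply: (special_Ldendriform_dual algR linDelta linnabla) => a c d.
    by rewrite pairD /brR' QN (bilinearDr bilf) !E adjP.
  by rewrite pairN /brR' QN opprK adjP.
- move=> circ dia x y.
  have pairdia a c d : pairing (dia a) c d = - form a (brR (P c) d)
    := pairC a c d.
  clearbody dia; apply: pairing_inj => c d.
  rewrite /circ !pairingE pairR pairlt_l pairrt paircirc_r circE !pairdia.
  rewrite pairD pairN !E.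
  have -> : P (br (P x) c + br x (P c)) = br (P x) (P c).
    by rewrite (linear_distrE P) addrC -rbP.
  (* Admissibility of [Q] for [brR] cancels the terms in [Q (br y d)]. What remains is the cocycle
     identity at [P x], [y], [P c], [d]. *)
  have -> : form x (brR (P c) (Q (br y d)))
      = form (P x) (brR (P c) (br y d)) - form (P x) (brR c (Q (br y d))).
    by rewrite !adjP admR (bilinearDr bilf) addrK.
  rewrite coc; ring.
- move=> dia x y T.
  have pairdia a c d : pairing (dia a) c d = - form a (brR (P c) d)
    := pairC a c d.
  clearbody dia; apply: pairing_inj => c d.
  rewrite pairingE pairing_tflip /T !pairingE !pairlt_r !pairdia /lt !E !adjQ.
  rewrite (brR_anti (P d) (br x _)) (brR_anti (P d) (br y _)).
  (* Antisymmetrizing in [c] and [d] joins the two terms with [P] outside [brR] into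
     [brR (P c) (P d)], by [rbPR]. *)
  have := coc x y (P c) (P d); rewrite rbPR (bilinearDr bilf) (brR_anti c).
  rewrite !E => /eqP; rewrite -subr_eq0 => /eqP <-; ring.
- move=> circ x y.
  (* The Rota-Baxter identity makes [P] of the commutator equal to [br (P x) (P y)], so the cocycle
     identity applies at [P x] and [P y]. *)
  have paircomm c d : pairing (nabla (commutator circ x y)) c d
      = form (br (P x) (P y)) (brR c d).
    rewrite pairN /commutator /circ !circE (lie_anti lie_br (P y)) opprK.
    by rewrite (linear_distrE P) addrC -rbP.
  apply: pairing_inj => c d.
  rewrite /circ !pairingE paircomm !paircirc_l !paircirc_r !pairN !E coc; ring.
Qed.

End Bialgebra.
End Duality.

(** * The double of [g]: form, operators, contraction of [r], semidirect bracket *)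

Lemma linear_big_sum (K : fieldType) (U W : vectType K) (f : U -> W)
    (I : Type) (s : seq I) (F : I -> U) : linear f ->
  f (\sum_(i <- s) F i) = \sum_(i <- s) f (F i).
Proof.
move=> linf; pose mf := GRing.isLinear.Build K U W _ f linf.
pose f' : {linear _ -> _} := HB.pack f mf.
exact: (linear_sum f').
Qed.

Section Double.
Variables (K : fieldType) (g : vectType K).
Implicit Types (a b c : gdual g) (u : 'Hom(g, K^o)).

Definition gdual_form a b : K^o :=
  (a.2 : 'Hom(g, K^o)) b.1 + (b.2 : 'Hom(g, K^o)) a.1.

Lemma gdual_form_bilinear : is_bilinear gdual_form.
Proof.
by split=> v k x y; rewrite /gdual_form /= linearP add_lfunE scale_lfunE
  scalerDr addrACA.
Qed.

Lemma gdual_form_sym a b : gdual_form a b = gdual_form b a.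
Proof. exact: addrC. Qed.

Let e := vbasis {:g}.
Let e_dual i : 'Hom(g, K^o) := linfun (coord e i : g -> K^o).

Lemma dual_decomp u : u = \sum_(i < \dim {:g}) u e`_i *: e_dual i.
Proof.
apply/lfunP=> x; rewrite sum_lfunE [x in LHS]vbasis_decomp linear_sum.
by apply: eq_bigr => i _; rewrite linearZ /= scale_lfunE lfunE [LHS]mulrC.
Qed.

Lemma gdual_inl_linear : linear (fun x : g => (x, 0) : gdual g).
Proof. by move=> k x y; congr pair; rewrite /= scaler0 addr0. Qed.

Lemma gdual_inr_linear : linear (fun u : dual g => (0, u) : gdual g).
Proof. by move=> k x y; congr pair; rewrite /= scaler0 addr0. Qed.

Lemma gdual_form_represents (f : {linear gdual g -> K^o}) :
  exists c, forall a, gdual_form a c = f a.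
Proof.
pose f1 (x : g) : K^o := f (x, 0).
have linf1 : linear f1.
  move=> k x y; rewrite /f1 -linearP; congr (f _).
  exact: gdual_inl_linear.
(* The component in [g] comes from the values of [f] on the dual basis, the component in the dual is
   the restriction of [f] to [g]. *)
exists (\sum_(i < \dim {:g}) (f (0, e_dual i : dual g) : K) *: e`_i,
  linfun f1 : dual g).
case=> x u; rewrite /gdual_form /= (linfunE linf1).
have -> : (x, u) = (x, 0) + (0, u) :> gdual g.
  by congr pair; rewrite /= ?addr0 ?add0r.
rewrite linearD addrC; congr (_ + _).
rewrite linear_sum [in RHS](dual_decomp u).
rewrite (linear_big_sum _ _ gdual_inr_linear).
rewrite linear_sum; apply: eq_bigr => i _.
rewrite (_ : (0, _) = u e`_i *: ((0, e_dual i : dual g) : gdual g)).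
  by rewrite !linearZ /= [LHS]mulrC.
by congr pair; rewrite /= scaler0.
Qed.

Section Operators.
Variables (S : 'End(g)) (T : 'End(dual g)).

Lemma opsum_linear : linear (opsum S T).
Proof. by move=> k a b; rewrite /opsum /= !linearP. Qed.

HB.instance Definition _ := GRing.isLinear.Build K (gdual g) (gdual g) _
  (opsum S T) opsum_linear.
End Operators.

Lemma opsum_adjoint (P Q : 'End(g)) a b :
  gdual_form (opsum Q (transpose P) a) b
  = gdual_form a (opsum P (transpose Q) b).
Proof. by rewrite /gdual_form /= !transposeE. Qed.

(** Contracting [optens P] expands [d.1] in the basis and applies [P]; contracting its flip expands
    [transpose P d.2] in the dual basis. *)
Lemma contract_rmatrix (P : 'End(g)) d :
  contract gdual_form d (rmatrix P) = opsum P (- transpose P) d.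
Proof.
have bil := gdual_form_bilinear.
have linC := @contract_linear _ _ gdual_form (gdual g) d.
have cP : contract gdual_form d (optens P) = (P d.1, 0).
  rewrite /optens (linear_big_sum _ _ linC) [in RHS](vbasis_decomp d.1).
  rewrite linear_sum (linear_big_sum _ _ gdual_inl_linear).
  apply: eq_bigr => i _; rewrite (contract_tpure bil) /gdual_form /= lfunE /=.
  by rewrite linear0 addr0; congr pair; rewrite /= ?scaler0 ?linearZ.
have cPt : contract gdual_form d (tflip (optens P)) = (0, transpose P d.2).
  rewrite /optens (linear_big_sum (f := @tflip _ _ _));
    last exact: tlift_linear.
  rewrite (linear_big_sum _ _ linC).
  rewrite [in RHS](dual_decomp (transpose P d.2)).
  rewrite (linear_big_sum _ _ gdual_inr_linear).
  apply: eq_bigr => i _; rewrite tflipE (contract_tpure bil) /gdual_form /=.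
  by rewrite lfunE add0r transposeE; congr pair; rewrite /= ?scaler0.
rewrite /rmatrix -scaleN1r addrC linC cP cPt.
by congr pair; rewrite /= ?scaler0 ?add0r ?addr0 // opp_lfunE scaleN1r.
Qed.

Variables (br : g -> g -> g).
Hypothesis lie_br : is_lie_bracket br.
Let bilb : is_bilinear br := lie_bilinear lie_br.
Let brD := semidirect_bracket br.

Lemma semidirect_lie : is_lie_bracket brD.
Proof.
have adE x u y : (ad_star br x u : 'Hom(g, K^o)) y = - u (br x y).
  exact: ad_starE.
split.
- have E := (bilinearE bilb, bilinearZr bilb, bilinearZl bilb).
  split=> v k x y; congr pair; rewrite /= ?bilb.1 ?bilb.2 //;
    apply/lfunP=> z; rewrite !(add_lfunE, opp_lfunE, scale_lfunE, adE) /= !E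
      !linearP /GRing.scale /=; ring.
- by move=> x; congr pair; rewrite /= ?(lie_alternating lie_br) ?subrr.
- move=> x y z; congr pair; rewrite /= ?(lie_jacobi lie_br) //.
  apply/lfunP=> w.
  rewrite !(add_lfunE, opp_lfunE, zero_lfunE, adE) /=.
  rewrite (lie_derivation lie_br x.1 y.1) (lie_derivation lie_br y.1 z.1).
  rewrite (lie_derivation lie_br z.1 x.1) !linearD /=; ring.
Qed.

Lemma gdual_form_invariant a b c :
  gdual_form (brD a b) c = gdual_form a (brD b c).
Proof.
rewrite /gdual_form /= !(add_lfunE, opp_lfunE, ad_starE) //=.
have lN (u : 'Hom(g, K^o)) x : u (- x) = - u x := linearN u x.
rewrite (lie_anti lie_br c.1) (lie_anti lie_br b.1 a.1) !lN; ring.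
Qed.

(** The component in [g] is the Rota-Baxter identity of [P]. The dual component, evaluated at [x],
    follows from admissibility after the transposes are moved onto [g]. *)
Lemma semidirect_rota_baxter (P Q : 'End(g)) :
  (forall x y, br (P x) (P y) = P (br x (P y)) + P (br (P x) y)) ->
  admissible br P Q ->
  let PQ := opsum P (transpose Q) in
  forall a b, brD (PQ a) (PQ b) = PQ (brD a (PQ b)) + PQ (brD (PQ a) b).
Proof.
move=> rbP admQ PQ a b; congr pair; rewrite /= ?rbP //.
apply/lfunP=> x.
rewrite !(add_lfunE, opp_lfunE, ad_starE, transposeE) //=.
have adm y z : Q (br (P y) z) = br (P y) (Q z) + Q (br y (Q z)).
  by have /eqP := admQ y z; rewrite -addrA -opprD subr_eq0 => /eqP.
have lD (u : 'Hom(g, K^o)) y z : u (y + z) = u y + u z := linearD u y z.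
rewrite !adm !lD; ring.
Qed.

End Double.

Theorem corollary4p26 (K : fieldType) (charK0 : [pchar K] =i pred0)
    (g : vectType K) (br : g -> g -> g) (P : 'End(g))
    (hP : is_rota_baxter_lie br P) :
  let brD : gdual g -> gdual g -> gdual g := semidirect_bracket br in
  let delta : gdual g -> tens (gdual g) (gdual g) := cobracket brD (rmatrix P) in
  (forall Q : 'End(g), admissible br P Q -> (P \o Q = Q \o P)%VF ->
    is_special_Ldendriform_bialg
      (fun a b => brD (opsum P (transpose Q) a) b
                  + opsum Q (transpose P) (brD a b))
      (fun a b => - opsum Q (transpose P) (brD a b))
      (fun a => tmap (opsum Q (transpose P)) id (delta a)
                + delta (opsum P (transpose Q) a))
      (fun a => - delta (opsum P (transpose Q) a)))
  /\ is_special_Ldendriform_bialg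
      (fun a b => brD (opsum P (- transpose P) a) b
                  + opsum (- P) (transpose P) (brD a b))
      (fun a b => - opsum (- P) (transpose P) (brD a b))
      (fun a => tmap (opsum (- P) (transpose P)) id (delta a)
                + delta (opsum P (- transpose P) a))
      (fun a => - delta (opsum P (- transpose P) a))
  /\ is_special_Ldendriform_bialg
      (fun a b => brD (opsum P 0 a) b
                  + opsum 0 (transpose P) (brD a b))
      (fun a b => - opsum 0 (transpose P) (brD a b))
      (fun a => tmap (opsum 0 (transpose P)) id (delta a)
                + delta (opsum P 0 a))
      (fun a => - delta (opsum P 0 a)).
Proof.
move=> brD delta; have [lie_br rbP] := hP.
(* The cases [Q = - P] and [Q = 0] are stated with [- transpose P] and [0]; these equations identify
   them with transposes of [Q]. *)
have trN : transpose (- P) = - transpose P.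
  apply/lfunP=> u; apply/lfunP=> x.
  by rewrite opp_lfunE transposeE !opp_lfunE linearN transposeE.
have tr0 : transpose (0 : 'End(g)) = 0.
  apply/lfunP=> u; apply/lfunP=> x.
  by rewrite transposeE !zero_lfunE linear0.
(* For [Q = - P], admissibility is the Rota-Baxter identity itself. *)
have admN : admissible br P (- P).
  move=> x y; rewrite !opp_lfunE.
  have PN : forall z, P (- z) = - P z := linearN P.
  by rewrite !(bilinearNr (lie_bilinear lie_br)) PN !opprK rbP addrCA addNr
    addr0 subrr.
have adm0 : admissible br P 0.
  move=> x y; rewrite !zero_lfunE (bilinear0r (lie_bilinear lie_br)).
  by rewrite !subr0.
have main (Q : 'End(g)) : admissible br P Q -> (P \o Q = Q \o P)%VF ->
    is_special_Ldendriform_bialg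
      (fun a b => brD (opsum P (transpose Q) a) b
                  + opsum Q (transpose P) (brD a b))
      (fun a b => - opsum Q (transpose P) (brD a b))
      (fun a => tmap (opsum Q (transpose P)) id (delta a)
                + delta (opsum P (transpose Q) a))
      (fun a => - delta (opsum P (transpose Q) a)).
  move=> admQ commPQ.
  have PQ x : P (Q x) = Q (P x).
    by have := congr1 (fun f : 'End(g) => f x) commPQ; rewrite !comp_lfunE.
  apply: (quadratic_rota_baxter_bialg (@gdual_form_bilinear K g)
    (@gdual_form_sym K g) (@gdual_form_represents K g)
    (R := opsum P (- transpose P))).
  - exact: semidirect_lie.
  - exact: gdual_form_invariant.
  - exact: semidirect_rota_baxter.
  - by rewrite -trN; exact: semidirect_rota_baxter.
  - exact: opsum_adjoint.
  - by move=> a b; rewrite /gdual_form /= !(opp_lfunE, transposeE) opprD opprK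
      addrC.
  - move=> a; congr pair => //=; apply/lfunP=> x.
    by rewrite !(opp_lfunE, transposeE) PQ.
  - exact: contract_rmatrix.
split=> //; split.
- rewrite -trN; apply: main => //.
  by rewrite comp_lfunNl comp_lfunNr.
- by have := main 0 adm0; rewrite tr0 comp_lfun0l comp_lfun0r; apply.
Qed.
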